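(* Consider linear search in which the robot moves with constant acceleration $c>0$ in either direction, starting from rest initially at the origin and again at every turning point (so that at time $t$ after starting from rest its speed is $ct$, and covering a distance $x$ from rest takes time $\sqrt{2x/c}$). Let $D=\{1,2,2^2,\ldots\}$ be the doubling strategy. Then $$3\left(\sqrt{2}+\frac{1}{\sqrt{2}}\right) \le \sigma^* \le \sigma_D \le \frac{2\sqrt{3}}{\sqrt{2}-1}+\sqrt{3}+1.$$
   Context: A robot starts at the origin of the real line and searches for a stationary target at an unknown point at distance $d$ from the origin (on either side). A zig-zag strategy is an infinite sequence $X=\{x_k\}_{k\ge1}$ of positive reals with $x_k<x_{k+2}$ for all $k$; the zig-zag search with strategy $X$ proceeds in rounds $k=1,2,\dots$: in an odd (resp. even) round the robot moves right (resp. left) from the origin a distance $x_k$, stopping if it reaches the target, and otherwise turns and returns to the origin (passing through the origin without stopping into the next round). $\sigma_X(d)$ denotes the ratio between the time the robot using $X$ needs to reach a target at distance $d$ (worst case over the target being at $+d$ or $-d$) and the time an omniscient robot, knowing the target's location and obeying the same movement rules (starting from rest at the origin), needs to travel from the origin directly to the target. The competitive ratio is $\sigma_X=\sup_{d>1}\sigma_X(d)$, and $\sigma^*$ denotes the optimal (infimum over all strategies) competitive ratio. *)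

(* Defs.v *)
From mathcomp Require Import all_boot all_order all_algebra.
From mathcomp Require Import all_classical all_reals all_analysis.
Set Implicit Arguments.
Unset Strict Implicit.
Unset Printing Implicit Defensive.
Import Order.TTheory GRing.Theory Num.Theory.
Local Open Scope classical_set_scope.
Local Open Scope ring_scope.

(** Linear search with constant acceleration.  Strategies are indexed from 0:
    [X k] is the distance usually written x_(k+1), so that rounds of odd number
    (to the right) correspond to even indices. *)

Definition zigzag_strategy (R : realType) (X : nat -> R) : Prop :=
  (forall k, 0 < X k) /\ (forall k, X k < X k.+2).

Definition doubling (R : realType) : nat -> R := fun k => 2 ^+ k.

(** Time to cover the distance [x] from rest: the solution of x = c t^2 / 2. *)
Definition travel_time (R : realType) (c x : R) : R := Num.sqrt (2 * x / c).

(** The points of the line where the robot is at rest: the origin, then x_1,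
    - x_2, x_3, ...; between two of them it passes through the origin
    without stopping. *)
Definition rest_point (R : realType) (X : nat -> R) (n : nat) : R :=
  if n is k.+1 then (-1) ^+ k * X k else 0.

Definition rest_time (R : realType) (c : R) (X : nat -> R) (n : nat) : R :=
  \sum_(i < n) travel_time c `|rest_point X i.+1 - rest_point X i|.

(** The robot, were it never to meet the target, is at [y] at time [t].  On the
    [n]-th leg it accelerates from rest, to the right when [n] is even. *)
Definition located_at (R : realType) (c : R) (X : nat -> R) (t y : R) : Prop :=
  exists n : nat,
    rest_time c X n <= t <= rest_time c X n.+1 /\
    y = rest_point X n + (-1) ^+ n * (c * (t - rest_time c X n) ^+ 2 / 2).

(** First time at which the robot is at [y]; it is [+oo] if this never happens
    (as for targets out of the range of a bounded strategy). *)
Definition search_time (R : realType) (c : R) (X : nat -> R) (y : R) : \bar R :=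
  ereal_inf [set t%:E | t in [set t : R | located_at c X t y]].

Definition ratio_at (R : realType) (c : R) (X : nat -> R) (d : R) : \bar R :=
  (maxe (search_time c X d) (search_time c X (- d)) *
     ((travel_time c d)^-1)%:E)%E.

Definition competitive_ratio (R : realType) (c : R) (X : nat -> R) : \bar R :=
  ereal_sup [set ratio_at c X d | d in [set d : R | 1 < d]].

Definition optimal_ratio (R : realType) (c : R) : \bar R :=
  ereal_inf [set competitive_ratio c X | X in @zigzag_strategy R].

(* Main.v *)
(** Lower bound: a target just beyond [X k] is missed on legs [0 .. k+1] and
    is only reached on the next leg on its side.  Since
    [sqrt (x + y) >= (sqrt x + sqrt y) / sqrt 2], a ratio [C] forces
    [2 S (k+2) + y k <= sqrt 2 C y k] with [y = sqrt X] and [S n] the sum of the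
    first [n] terms of [y], that is [S (k+2) <= B (S (k+1) - S k)] with
    [B = (sqrt 2 C - 1) / 2].  As in the classical cow-path argument
    this is impossible for [B < 4], and [B = 4] is [C = 9 / sqrt 2].
    Upper bound: if [2^m < d <= 2^(m+1)] then both targets are reached by the
    end of leg [m+2], and the time spent until then is a geometric sum. *)

Require Import Defs.
From mathcomp Require Import all_boot all_order all_algebra.
From mathcomp Require Import all_classical all_reals all_analysis.
From mathcomp Require Import ring lra zify.
Set Implicit Arguments.
Unset Strict Implicit.
Unset Printing Implicit Defensive.
Import Order.TTheory GRing.Theory Num.Theory.
Local Open Scope classical_set_scope.
Local Open Scope ring_scope.

(** * A recurrence without positive solutions *)

Lemma no_slow_positive_sequence (R : realType) (C : R) (a : nat -> R) :
  0 < C -> C < 4 -> (forall n, 0 < a n) ->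
  ~ (forall n, a n.+2 <= C * (a n.+1 - a n)).
Proof.
move=> C0 C4 a0 ha.
pose r n := a n.+1 / a n.
have r0 n : 0 < r n by rewrite divr_gt0.
pose e := C - C ^+ 2 / 4.
have e0 : 0 < e by rewrite /e; nra.
(* [r n * r n.+1 <= C * (r n - 1)], and [C * (r - 1) <= r ^+ 2 - e] for all
   [r], so [r] would decrease linearly. *)
have step n : r n * r n.+1 <= r n ^+ 2 - e.
  have -> : r n * r n.+1 = a n.+2 / a n.
    by rewrite /r; field; rewrite !gt_eqF.
  apply: (@le_trans _ _ (C * (r n - 1))).
    have -> : C * (r n - 1) = C * (a n.+1 - a n) / a n.
      by rewrite /r; field; rewrite !gt_eqF.
    by rewrite ler_pM2r ?invr_gt0.
  by rewrite /e; have := sqr_ge0 (r n - C / 2); nra.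
(* The ratios never exceed [r 0], so each decrement [e / r n] is at least [e / r 0]; positivity of
   [r] then fails for large [n]. *)
have drop n : r n <= r 0%N - n%:R * (e / r 0%N).
  have de : 0 < e / r 0%N by rewrite divr_gt0.
  elim: n => [|n IH]; first by rewrite mul0r subr0.
  have rn0 : r n <= r 0%N.
    by apply: le_trans IH _; rewrite gerBl mulr_ge0 // ltW.
  have : r n.+1 <= r n - e / r n.
    rewrite -(ler_pM2l (r0 n)) mulrBr [X in _ <= _ - X]mulrCA divff ?gt_eqF // mulr1 -expr2.
    exact: step.
  have : e / r 0%N <= e / r n by rewrite ler_pM2l // lef_pV2 // posrE.
  by rewrite -natr1; lra.
pose n := (Num.truncn (r 0%N / (e / r 0%N))).+1.
have de : 0 < e / r 0%N by rewrite divr_gt0.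
have : r 0%N < n%:R * (e / r 0%N).
  by rewrite -ltr_pdivrMr // /n truncnS_gt.
have := drop n; have := r0 n; lra.
Qed.

(** * Kinematics of a single leg *)

Section Motion.
Variables (R : realType) (c : R).
Hypothesis hc : 0 < c.

Lemma travel_time_ge0 x : 0 <= travel_time c x.
Proof. exact: sqrtr_ge0. Qed.

Lemma travel_timeE x : travel_time c x = Num.sqrt (2 / c) * Num.sqrt x.
Proof. by rewrite /travel_time mulrAC sqrtrM // divr_ge0 // ltW. Qed.

Lemma travel_time_gt0 x : 0 < x -> 0 < travel_time c x.
Proof. by move=> x0; rewrite sqrtr_gt0 divr_gt0 // mulr_gt0. Qed.

Lemma ler_travel_time x y : 0 <= y ->
  (travel_time c x <= travel_time c y) = (x <= y).
Proof.
move=> y0; rewrite ler_sqrt; last by rewrite divr_ge0 ?mulr_ge0 // ltW.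
by rewrite ler_pM2r ?invr_gt0 // ler_pM2l.
Qed.

Lemma travel_timeK x : 0 <= x -> c * travel_time c x ^+ 2 / 2 = x.
Proof.
move=> x0; rewrite sqr_sqrtr; last by rewrite divr_ge0 ?mulr_ge0 // ltW.
by field; rewrite gt_eqF.
Qed.

Lemma travel_time_sqr t : 0 <= t -> travel_time c (c * t ^+ 2 / 2) = t.
Proof.
move=> t0; rewrite /travel_time.
have -> : 2 * (c * t ^+ 2 / 2) / c = t ^+ 2 by field; rewrite gt_eqF.
by rewrite sqrtr_sqr ger0_norm.
Qed.

(** Concavity of the square root; it splits the time of a leg into contributions of its two arms, on
    either side of the origin. *)
Lemma travel_time_midpoint x y : 0 <= x -> 0 <= y ->
  Num.sqrt (2 / c) * (Num.sqrt x + Num.sqrt y) <=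
  Num.sqrt 2 * travel_time c (x + y).
Proof.
move=> x0 y0; rewrite travel_timeE mulrCA ler_wpM2l ?sqrtr_ge0 //.
rewrite -sqrtrM // -[leLHS]ger0_norm ?addr_ge0 ?sqrtr_ge0 //.
rewrite -sqrtr_sqr ler_wsqrtr // sqrrD !sqr_sqrtr //.
have := sqr_ge0 (Num.sqrt x - Num.sqrt y).
rewrite sqrrB !sqr_sqrtr //; lra.
Qed.

(** * Search times of a general strategy *)

Section Strategy.
Variable X : nat -> R.
Hypothesis hX : zigzag_strategy X.

Local Notation T := (rest_time c X).
Local Notation p := (rest_point X).

Let X_gt0 k : 0 < X k. Proof. by case: hX. Qed.

Lemma strategy_parity_homo j k :
  odd j = odd k -> (j <= k)%N -> X j <= X k.
Proof.
move=> ojk jk.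
have -> : k = (j + (k - j)./2.*2)%N by move: ojk jk; lia.
elim: (k - j)./2 => [|n IH]; first by rewrite addn0.
by rewrite doubleS !addnS; apply: le_trans IH (ltW _); case: hX.
Qed.

(** Leg [k] heads in direction [(-1) ^+ k], hence starts on the other side; the absolute value lets
    this form include the start at the origin. *)
Lemma rest_pointE k : p k = - (-1) ^+ k * `|p k|.
Proof.
case: k => [|k] /=; first by rewrite normr0 mulr0.
by rewrite normrM normr_sign mul1r gtr0_norm // exprS mulN1r opprK.
Qed.

Lemma norm_rest_pointS k : `|p k.+1| = X k.
Proof. by rewrite /= normrM normr_sign mul1r gtr0_norm. Qed.

Lemma leg_length k : `|p k.+1 - p k| = `|p k| + X k.
Proof.
rewrite {1}[p k]rest_pointE /= mulNr opprK -mulrDr normrM normr_sign mul1r.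
by rewrite addrC ger0_norm // addr_ge0 // ltW.
Qed.

Lemma rest_timeS k : T k.+1 = T k + travel_time c (`|p k| + X k).
Proof. by rewrite /rest_time big_ord_recr /= leg_length. Qed.

Lemma rest_time_homo : {homo T : j k / (j <= k)%N >-> j <= k}.
Proof.
apply: homo_leq => [//|x y z|k]; first exact: le_trans.
by rewrite rest_timeS lerDl travel_time_ge0.
Qed.

Lemma ler_leg_time k d e : 0 <= e ->
  (travel_time c (`|p k| + d) <= travel_time c (`|p k| + e)) = (d <= e).
Proof. by move=> e0; rewrite ler_travel_time ?lerD2l // addr_ge0. Qed.

Lemma search_time_le k d : 0 <= d -> d <= X k ->
  (search_time c X ((-1) ^+ k * d)%R <= (T k.+1)%:E)%E.
Proof.
move=> d0 dX; set t := T k + travel_time c (`|p k| + d).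
have tT : t <= T k.+1 by rewrite rest_timeS lerD2l ler_leg_time // (le_trans d0).
apply: (@le_trans _ _ t%:E); last by rewrite lee_fin.
apply: ereal_inf_lbound; exists t => //=.
exists k; split; first by rewrite tT lerDl travel_time_ge0.
rewrite /t [T k + _]addrC addrK travel_timeK ?addr_ge0 //.
by rewrite {1}[p k]rest_pointE; ring.
Qed.

(* A leg started on the opposite side may also cross the target on its way
   back; the leg before it had then already visited the target. *)
Lemma located_first_visit t k (d : R) : 0 < d ->
  located_at c X t ((-1) ^+ k * d) ->
  exists m, [/\ odd m = odd k, d <= X m &
                T m + travel_time c (`|p m| + d) <= t].
Proof.
move=> d0 [n [/andP[tn tS] ey]].
set s := c * (t - T n) ^+ 2 / 2 in ey.
have s0 : 0 <= s by rewrite divr_ge0 // mulr_ge0 ?sqr_ge0 // ltW.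
have ts : travel_time c s = t - T n by rewrite travel_time_sqr // subr_ge0.
have sX : s <= `|p n| + X n.
  have pX : 0 <= `|p n| + X n by rewrite addr_ge0 // ltW.
  rewrite -[leRHS]travel_timeK // /s ler_pM2r ?invr_gt0 // ler_pM2l //.
  rewrite ler_sqr ?nnegrE ?subr_ge0 ?travel_time_ge0 //.
  by rewrite lerBlDl -rest_timeS.
clearbody s; have {}ey : (-1) ^+ n * ((-1) ^+ k * d) = s - `|p n|.
  rewrite ey {1}[p n]rest_pointE mulrDr mulNr mulrN !mulrA -expr2.
  by rewrite sqrr_sign !mul1r addrC.
rewrite mulrA -exprD -signr_odd oddD in ey.
have [onk|onk] := eqVneq (odd n) (odd k).
  exists n; rewrite onk addbb expr0 mul1r in ey; split => //; first lra.
  by rewrite ey subrKC ts subrKC.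
have ebn : odd n (+) odd k by move: onk; case: (odd n) (odd k) => [] [].
rewrite ebn expr1 mulN1r in ey.
(* Leg 0 starts at the origin and never enters the opposite side. *)
case: n => [|n] in tn tS onk ebn s s0 ts sX ey *.
  by rewrite normr0 in ey; lra.
rewrite norm_rest_pointS in ey.
have dX : d <= X n by lra.
exists n; split => //; first by move: ebn => /=; case: (odd n) (odd k) => [] [].
by apply: le_trans tn; rewrite rest_timeS lerD2l ler_leg_time ?(ltW (X_gt0 _)).
Qed.

(** By parity and monotonicity the first visit is on leg [k.+2] or later. Leg [k.+2] needs a run of
    [X k.+1 + d] from rest; a later leg comes after leg [k.+2] is completed, and that leg is longer
    than [X k.+1 + X k]. *)
Lemma search_time_ge k d : X k < d ->
  ((T k.+2 + travel_time c (X k.+1 + X k))%:E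
     <= search_time c X ((-1) ^+ k * d)%R)%E.
Proof.
move=> kd; have d0 : 0 < d by exact: lt_trans (X_gt0 k) kd.
apply: le_ereal_inf_tmp => _ [t /= /(located_first_visit d0)[m [omk dm mt]] <-].
rewrite lee_fin; apply: le_trans mt.
have km : (k < m)%N.
  rewrite ltnNge; apply/negP => /(strategy_parity_homo omk) mk.
  by have := lt_le_trans kd (le_trans dm mk); rewrite ltxx.
have [->|mk] := eqVneq m k.+2.
  by rewrite -norm_rest_pointS lerD2l ler_leg_time ltW.
have {}mk : (k.+3 <= m)%N by move: omk km mk; lia.
apply: (@le_trans _ _ (T m)); last by rewrite lerDl travel_time_ge0.
apply: le_trans (rest_time_homo mk).
rewrite [T k.+3]rest_timeS -[X k.+1]norm_rest_pointS lerD2l ler_leg_time ltW //.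
by case: hX.
Qed.

(** * The lower bound *)

(** Each arm belongs to two consecutive legs, outward and back, except the last, which is only run
    outward. *)
Lemma rest_time_sqrt_sum k :
  Num.sqrt (2 / c) *
    (2 * (\sum_(i < k.+1) Num.sqrt (X i)) - Num.sqrt (X k)) <=
  Num.sqrt 2 * T k.+1.
Proof.
elim: k => [|k IH].
  rewrite rest_timeS /rest_time big_ord0 add0r big_ord1 normr0.
  apply: le_trans (travel_time_midpoint (lexx 0) (ltW (X_gt0 0))).
  by rewrite sqrtr0 ler_wpM2l ?sqrtr_ge0 //; lra.
rewrite big_ord_recr rest_timeS norm_rest_pointS mulrDr /=.
have := travel_time_midpoint (ltW (X_gt0 k)) (ltW (X_gt0 k.+1)).
move: IH; rewrite !mulrDr !mulrN; lra.
Qed.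

Lemma ratio_at_leP C d : 0 < d ->
  (ratio_at c X d <= C%:E)%E <->
  forall k, (search_time c X ((-1) ^+ k * d)%R <= (C * travel_time c d)%:E)%E.
Proof.
move=> d0; rewrite /ratio_at lee_pdivrMr ?travel_time_gt0 // -EFinM ge_max.
split=> [/andP[h1 h2] k|h].
  by rewrite -signr_odd; case: (odd k); rewrite ?expr0 ?expr1 ?mul1r ?mulN1r.
by have := h 0%N; have := h 1%N; rewrite expr0 expr1 mul1r mulN1r => -> ->.
Qed.

Lemma search_time_le_ratio C d k : (competitive_ratio c X <= C%:E)%E ->
  1 < d ->
  (search_time c X ((-1) ^+ k * d)%R <= (C * travel_time c d)%:E)%E.
Proof.
move=> hC d1; have d0 : 0 < d by exact: lt_trans d1.
apply: (ratio_at_leP C d0).1.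
by apply: le_trans hC; apply: ereal_sup_ubound; exists d.
Qed.

(** A finite ratio forces the targets at 2 and -2 to be found, so each side has an arm of length at
    least 2. This matters because the ratio only constrains targets beyond distance 1. *)
Lemma eventually_gt1 C : (competitive_ratio c X <= C%:E)%E ->
  exists K, forall k, (K <= k)%N -> 1 < X k.
Proof.
move=> hC.
have ex k : exists m, odd m = odd k /\ 1 < X m.
  have h : 1 < 2 :> R by rewrite ltr1n.
  have := le_lt_trans (search_time_le_ratio k hC h) (ltry _).
  rewrite /search_time => /ereal_inf_lt[_ [t /= ht <-] _].
  have [m [om m2 _]] := located_first_visit (ltr0n _ 2) ht.
  by exists m; split => //; apply: lt_le_trans m2; rewrite ltr1n.
have [m0 [par0 h0]] := ex 0%N; have [m1 [par1 h1]] := ex 1%N.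
exists (maxn m0 m1) => k; rewrite geq_max => /andP[k0 k1].
case ok : (odd k).
  by apply: lt_le_trans h1 _; apply: strategy_parity_homo; rewrite ?ok.
by apply: lt_le_trans h0 _; apply: strategy_parity_homo; rewrite ?ok.
Qed.

Lemma turn_bound C k : (competitive_ratio c X <= C%:E)%E -> 1 < X k ->
  T k.+2 + travel_time c (X k.+1 + X k) <= C * travel_time c (X k).
Proof.
move=> hC Xk; set A := _ + _.
have A0 : 0 < A.
  rewrite ltr_wpDl ?travel_time_gt0 ?addr_gt0 //.
  by rewrite sumr_ge0 // => *; exact: sqrtr_ge0.
have key d : X k < d -> A <= C * travel_time c d.
  move=> kd; rewrite -lee_fin; apply: le_trans (search_time_ge kd) _.
  by apply: search_time_le_ratio => //; exact: lt_trans kd.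
have C0 : 0 < C.
  have X1 : X k < X k + 1 by rewrite ltrDl.
  have := lt_le_trans A0 (key _ X1).
  by rewrite pmulr_lgt0 // travel_time_gt0 // (lt_trans _ X1).
rewrite leNgt; apply/negP => ltA.
(* In place of a limit [d -> X k]: [d0] is the distance with [C * travel_time c d0 = A], and a
   target halfway between [X k] and [d0] gives the contradiction. *)
pose d0 := c * (A / C) ^+ 2 / 2.
have d0E : travel_time c d0 = A / C.
  by rewrite travel_time_sqr // divr_ge0 // ltW.
have kd0 : X k < d0.
  rewrite ltNge -ler_travel_time ?(ltW (X_gt0 _)) // -ltNge d0E.
  by rewrite ltr_pdivlMr // mulrC.
have /key : X k < (X k + d0) / 2 by lra.
rewrite mulrC -ler_pdivrMr // -d0E ler_travel_time; first lra.
by have := X_gt0 k; lra.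
Qed.

Lemma competitive_ratio_ge :
  ((3 * (Num.sqrt 2 + 1 / Num.sqrt 2))%:E <= competitive_ratio c X)%E.
Proof.
set q := Num.sqrt 2; have q0 : 0 < q by rewrite sqrtr_gt0.
have qq : q ^+ 2 = 2 by rewrite sqr_sqrtr.
rewrite leNgt; apply/negP => ltq.
have [C [hC Cq]] : exists C, (competitive_ratio c X <= C%:E)%E /\
    C < 3 * (q + 1 / q).
  case E: (competitive_ratio c X) ltq => [r||] ltq //.
    by exists r; rewrite lexx -lte_fin.
  (* Value [-oo]: any real below the bound would do. *)
  by exists 0; split; rewrite ?leNye // mulr_gt0 // addr_gt0 // divr_gt0.
have {}Cq : q * C < 9.
  have <- : q * (3 * (q + 1 / q)) = 9.
    have -> : q * (3 * (q + 1 / q)) = 3 * (q ^+ 2 + 1).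
      by field; rewrite gt_eqF.
    by rewrite qq; ring.
  by rewrite ltr_pM2l.
have [K hK] := eventually_gt1 hC.
(* The sums keep all the early terms; only the index is shifted by [K], so that [turn_bound] applies
   at every step. *)
pose a n := \sum_(i < (K + n).+1) Num.sqrt (X i).
have a0 n : 0 < a n.
  by rewrite /a big_ord_recr ltr_wpDl ?sqrtr_gt0 // sumr_ge0 //.
have aS n : a n.+1 - a n = Num.sqrt (X (K + n).+1).
  by rewrite /a addnS big_ord_recr /= addrC addrK.
have ha n : a n.+2 <= (q * C - 1) / 2 * (a n.+1 - a n).
  rewrite aS; set k := (K + n).+1.
  have s0 : 0 < Num.sqrt (2 / c) by rewrite sqrtr_gt0 divr_gt0.
  have := rest_time_sqrt_sum k.+1.
  have -> : \sum_(i < k.+2) Num.sqrt (X i) = a n.+2.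
    by rewrite /a !addnS.
  have := travel_time_midpoint (ltW (X_gt0 k.+1)) (ltW (X_gt0 k)).
  have Xk : 1 < X k by apply: hK; rewrite /k; lia.
  have := ler_wpM2l (ltW q0) (turn_bound hC Xk).
  (* On adding the three inequalities the terms in [X k.+1] cancel, leaving [2 * a n.+2 <= (q * C -
     1) * Num.sqrt (X k)] up to the factor [Num.sqrt (2 / c)]. *)
  rewrite [travel_time c (X k)]travel_timeE -/q => h1 h2 h3; rewrite -(ler_pM2l s0); lra.
have C0 : 0 < (q * C - 1) / 2.
  have := lt_le_trans (a0 2) (ha 0%N).
  by rewrite aS pmulr_lgt0 // sqrtr_gt0.
by apply: (no_slow_positive_sequence C0 _ a0 ha); lra.
Qed.

(** Legs [k] and [k.+1] cover opposite sides, so one of them meets the target. *)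
Lemma search_time_le_consecutive k j d : 0 <= d -> d <= X k -> d <= X k.+1 ->
  (search_time c X ((-1) ^+ j * d)%R <= (T k.+2)%:E)%E.
Proof.
move=> d0 dk dk1; have [ojk|ojk] := eqVneq (odd j) (odd k).
  rewrite -signr_odd ojk signr_odd.
  apply: le_trans (search_time_le d0 dk) _.
  by rewrite lee_fin rest_time_homo.
have -> : (-1) ^+ j = (-1) ^+ k.+1 :> R.
  by rewrite -signr_odd -[RHS]signr_odd /=; case: (odd j) (odd k) ojk => [] [].
exact: search_time_le.
Qed.
End Strategy.

(** * The doubling strategy *)

Lemma doubling_zigzag : zigzag_strategy (@doubling R).
Proof.
by split=> k; rewrite /doubling ?exprn_gt0 // ltr_eXn2l ?ltr1n.
Qed.

(** The first leg has length 1 and gives the summand 1; leg [n.+1] has length [3 * 2 ^+ n], so the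
    others form a geometric sum of ratio [Num.sqrt 2]. *)
Lemma rest_time_doubling k :
  rest_time c (@doubling R) k.+2 =
  Num.sqrt (2 / c) *
    (1 + Num.sqrt 3 * ((Num.sqrt 2 ^+ k.+1 - 1) / (Num.sqrt 2 - 1))).
Proof.
set q := Num.sqrt 2.
have q1 : 1 < q by rewrite -[ltLHS]sqrtr1 ltr_sqrt // ltr1n.
have q10 : q - 1 != 0 by rewrite subr_eq0 gt_eqF.
have legE n : travel_time c (2 ^+ n + 2 ^+ n.+1) =
    Num.sqrt (2 / c) * (Num.sqrt 3 * q ^+ n).
  rewrite travel_timeE exprS (_ : 2 ^+ n + 2 * 2 ^+ n = 3 * 2 ^+ n); last by ring.
  rewrite [Num.sqrt (3 * _)]sqrtrM //; congr (_ * (_ * _)).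
  elim: n => [|n IH]; first by rewrite !expr0 sqrtr1.
  by rewrite !exprS sqrtrM // IH.
elim: k => [|k IH]; rewrite (rest_timeS doubling_zigzag).
  rewrite (rest_timeS doubling_zigzag) /rest_time big_ord0 add0r normr0 add0r.
  rewrite (norm_rest_pointS doubling_zigzag) legE travel_timeE /doubling.
  by rewrite !expr0 sqrtr1 expr1 divff //; ring.
rewrite IH (norm_rest_pointS doubling_zigzag) legE [in RHS]exprS.
by field.
Qed.

Lemma dyadic_bracket (d : R) : 1 < d ->
  exists m : nat, 2 ^+ m < d /\ d <= 2 ^+ m.+1.
Proof.
move=> d1; have : exists n : nat, d <= 2 ^+ n.
  exists (Num.truncn d).+1; apply/ltW/(lt_trans (truncnS_gt _)).
  by rewrite -natrX ltr_nat ltn_expl.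
case/ex_minnP => -[|m] dm min; first by rewrite leNgt d1 in dm.
exists m; split => //; rewrite ltNge; apply/negP => /min.
by rewrite ltnn.
Qed.

Lemma competitive_ratio_doubling_le :
  (competitive_ratio c (@doubling R)
     <= (2 * Num.sqrt 3 / (Num.sqrt 2 - 1) + Num.sqrt 3 + 1)%:E)%E.
Proof.
apply: ge_ereal_sup => _ [d /= d1 <-].
have d0 : 0 < d by exact: lt_trans d1.
apply/(ratio_at_leP _ _ d0) => j.
have [m [md dm]] := dyadic_bracket d1.
apply: le_trans (search_time_le_consecutive doubling_zigzag j (ltW d0) dm _) _.
  by apply: le_trans dm _; rewrite ler_eXn2l // ltr1n.
rewrite lee_fin rest_time_doubling travel_timeE [leRHS]mulrCA.
rewrite ler_wpM2l ?sqrtr_ge0 //.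
set q := Num.sqrt 2; set r := Num.sqrt 3.
have q1 : 1 < q by rewrite -[ltLHS]sqrtr1 ltr_sqrt // ltr1n.
have r0 : 0 <= r by exact: sqrtr_ge0.
have qq : q ^+ 2 = 2 by rewrite sqr_sqrtr.
set w := q ^+ m.
have w1 : 1 <= w by rewrite exprn_ege1 // ltW.
have wd : w <= Num.sqrt d.
  rewrite -[w]ger0_norm ?(le_trans ler01) // -sqrtr_sqr ler_wsqrtr //.
  by rewrite /w exprAC qq ltW.
have -> : q ^+ m.+2 = 2 * w by rewrite /w -qq -exprD.
set u := (q - 1)^-1; have u0 : 0 <= u by rewrite invr_ge0 subr_ge0 ltW.
have ru : 0 <= r * u by rewrite mulr_ge0.
have C0 : 0 <= 2 * r * u + r + 1 by lra.
(* With [Num.sqrt d] lowered to [w], the terms [2 * r * u * w] cancel and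
   [0 <= r * u + r * w + (w - 1)] remains. *)
apply: le_trans (ler_wpM2l C0 wd); nra.
Qed.
End Motion.

Theorem theorem4 (R : realType) (c : R) (hc : 0 < c) :
  [/\ ((3 * (Num.sqrt 2 + 1 / Num.sqrt 2))%:E <= optimal_ratio c)%E,
      (optimal_ratio c <= competitive_ratio c (@doubling R))%E
    & (competitive_ratio c (@doubling R)
         <= (2 * Num.sqrt 3 / (Num.sqrt 2 - 1) + Num.sqrt 3 + 1)%:E)%E].
Proof.
split; last exact: competitive_ratio_doubling_le.
  by apply: le_ereal_inf_tmp => _ [X hX <-]; exact: competitive_ratio_ge.
apply: ereal_inf_lbound; exists (@doubling R) => //; exact: doubling_zigzag.
Qed.
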